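(* Let $\Delta$ be a non-empty connected finite flag complex. Then the group $H_\Delta$ has a presentation with generators the set of directed edges of $\Delta$, and relators all words of the form $e_1^n e_2^n\cdots e_l^n$, where $l,n\in\mathbf{Z}$, $n\neq 0$, $l\geq 2$, and $(e_1,\ldots,e_l)$ is a directed cycle in $\Delta$. In terms of the given generators for $G_\Delta$ (the vertices of $\Delta$), the generator corresponding to the directed edge $e$ is the element $e=\iota e\,(\tau e)^{-1}$ of $H_\Delta\leq G_\Delta$.
   Context: A finite flag complex $\Delta$ is a finite simplicial complex that contains a simplex bounding (spanning) every complete subgraph of its 1-skeleton. The associated right-angled Artin group $G_\Delta$ is the group presented with generators the vertex set of $\Delta$ and relators the commutators $[v,w]$ for each pair of adjacent vertices $v,w$ of $\Delta$. For $\Delta$ non-empty, there is a homomorphism $G_\Delta\to\mathbf{Z}$ sending every generator to $1$, and $H_\Delta$ denotes its kernel. A directed edge is a 1-simplex of $\Delta$ together with a choice of orientation (so each 1-simplex gives two directed edges, each being the opposite of the other). For a directed edge $e$, $\iota e$ denotes its initial vertex and $\tau e$ its terminal vertex. A directed cycle $(e_1,\ldots,e_l)$ of length $l$ is a closed directed edge path: $\tau e_i=\iota e_{i+1}$ for $1\le i<l$ and $\tau e_l=\iota e_1$ (in particular, directed cycles of length 2 are the pairs $(e,\bar e)$, where $\bar e$ is $e$ with its opposite orientation). *)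

(* Defs.v *)
From HB Require Import structures.
From mathcomp Require Import all_boot all_algebra.
From mathcomp Require Import boolp.

Set Implicit Arguments.
Unset Strict Implicit.
Unset Printing Implicit Defensive.

Local Open Scope group_scope.
Local Open Scope quotient_scope.

Section Words.
Variable X : choiceType.

(* The letter (x, true) stands for x and (x, false) for x^-1. *)
Definition word := seq (X * bool).

Definition inv_letter (l : X * bool) : X * bool := (l.1, ~~ l.2).

Definition inv_word (w : word) : word := rev (map inv_letter w).

Definition pow_word (x : X) (n : int) : word :=
  match n with
  | Posz k => nseq k (x, true)
  | Negz k => nseq k.+1 (x, false)
  end.

Definition comm_word (x y : X) : word :=
  [:: (x, false); (y, false); (x, true); (y, true)].

(* The congruence on words whose quotient is the group < X | R >. *)
Inductive pres_eq (R : word -> Prop) : word -> word -> Prop :=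
  | pres_refl w : pres_eq R w w
  | pres_sym u v : pres_eq R u v -> pres_eq R v u
  | pres_trans v u w : pres_eq R u v -> pres_eq R v w -> pres_eq R u w
  | pres_cat u u' v v' :
      pres_eq R u u' -> pres_eq R v v' -> pres_eq R (u ++ v) (u' ++ v')
  | pres_cancel l : pres_eq R [:: l; inv_letter l] [::]
  | pres_relator r : R r -> pres_eq R r [::].

Definition eval_word (G : groupType) (f : X -> G) (w : word) : G :=
  \prod_(l <- w) (if l.2 then f l.1 else (f l.1)^-1).

Lemma eval_word_cat (G : groupType) (f : X -> G) u v :
  eval_word f (u ++ v) = eval_word f u * eval_word f v.
Proof. exact: big_cat. Qed.

Lemma eval_word_pres_eq (G : groupType) (f : X -> G) (R : word -> Prop) u v :
  (forall r, R r -> eval_word f r = 1) ->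
  pres_eq R u v -> eval_word f u = eval_word f v.
Proof.
move=> fR; elim=> //.
- by move=> ? ? ? _ -> _ ->.
- by move=> ? ? ? ? _ eu _ ev; rewrite !eval_word_cat eu ev.
- case=> x []; rewrite /eval_word !big_cons !big_nil /= mulg1.
    by rewrite mulgV.
  by rewrite mulVg.
- by move=> r /fR ->; rewrite /eval_word big_nil.
Qed.

End Words.

Section PresentedGroup.
Variables (X : choiceType) (R : word X -> Prop).

Definition pres_eqb (u v : word X) : bool := `[< pres_eq R u v >].

Lemma pres_eqb_equiv : equiv_class_of pres_eqb.
Proof.
split.
- by move=> w; apply/asboolP/pres_refl.
- by move=> u v; apply/asboolP/asboolP => /pres_sym.
- move=> v u w /asboolP uv /asboolP vw; apply/asboolP.
  exact: pres_trans uv vw.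
Qed.

Canonical pres_equiv := EquivRelPack pres_eqb_equiv.

(* The group < X | R >. *)
Definition pres_group := {eq_quot pres_equiv}.

HB.instance Definition _ := Choice.on pres_group.
HB.instance Definition _ := EqQuotient.on pres_group.

Definition pres_class (w : word X) : pres_group := \pi_pres_group w.

Lemma pres_classP u v : pres_class u = pres_class v <-> pres_eq R u v.
Proof.
split; first by move=> /eqmodP /asboolP.
by move=> uv; apply/eqmodP/asboolP.
Qed.

Lemma pres_class_repr (g : pres_group) : pres_class (repr g) = g.
Proof. exact: reprK. Qed.

Lemma pres_eq_repr w : pres_eq R (repr (pres_class w)) w.
Proof. by apply/pres_classP; rewrite pres_class_repr. Qed.

Definition pres_mul (g h : pres_group) : pres_group :=
  pres_class (repr g ++ repr h).
Definition pres_one : pres_group := pres_class [::].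
Definition pres_inv (g : pres_group) : pres_group :=
  pres_class (inv_word (repr g)).

Lemma pres_class_cat u v :
  pres_mul (pres_class u) (pres_class v) = pres_class (u ++ v).
Proof. by apply/pres_classP; apply: pres_cat; apply: pres_eq_repr. Qed.

Lemma inv_letterK : involutive (@inv_letter X).
Proof. by case=> x b; rewrite /inv_letter /= negbK. Qed.

Lemma inv_wordK : involutive (@inv_word X).
Proof.
by move=> w; rewrite /inv_word map_rev revK mapK //; apply: inv_letterK.
Qed.

Lemma pres_eq_catV w : pres_eq R (w ++ inv_word w) [::].
Proof.
elim: w => [|l w IHw]; first exact: pres_refl.
have -> : (l :: w) ++ inv_word (l :: w)
        = [:: l] ++ (w ++ inv_word w) ++ [:: inv_letter l].
  by rewrite /inv_word /= rev_cons -cats1 catA.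
apply: (@pres_trans _ _ ([:: l] ++ [::] ++ [:: inv_letter l])).
  apply: pres_cat; first exact: pres_refl.
  by apply: pres_cat; [exact: IHw|exact: pres_refl].
exact: pres_cancel.
Qed.

Lemma pres_mulA : associative pres_mul.
Proof.
move=> g h k.
rewrite -(pres_class_repr g) -(pres_class_repr h) -(pres_class_repr k).
by rewrite !pres_class_cat catA.
Qed.

Lemma pres_mul1 : left_id pres_one pres_mul.
Proof. by move=> g; rewrite -(pres_class_repr g) pres_class_cat. Qed.

Lemma pres_1mul : right_id pres_one pres_mul.
Proof. by move=> g; rewrite -(pres_class_repr g) pres_class_cat cats0. Qed.

Lemma pres_mulV : right_inverse pres_one pres_inv pres_mul.
Proof.
move=> g; rewrite -{1}(pres_class_repr g) pres_class_cat.
by apply/pres_classP/pres_eq_catV.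
Qed.

Lemma pres_Vmul : left_inverse pres_one pres_inv pres_mul.
Proof.
move=> g; rewrite -{2}(pres_class_repr g) pres_class_cat.
apply/pres_classP; rewrite -{2}(inv_wordK (repr g)).
exact: pres_eq_catV.
Qed.

HB.instance Definition _ := isGroup.Build pres_group
  pres_mulA pres_mul1 pres_1mul pres_Vmul pres_mulV.

Definition pres_gen (x : X) : pres_group := pres_class [:: (x, true)].

Lemma pres_classM u v : pres_class (u ++ v) = pres_class u * pres_class v.
Proof. by rewrite -pres_class_cat. Qed.

(* The map < X | R > -> G extending f; it is a morphism as soon as f kills all
   the relators. *)
Definition pres_lift (G : groupType) (f : X -> G) (g : pres_group) : G :=
  eval_word f (repr g).

Section Lift.
Variables (G : groupType) (f : X -> G).
Hypothesis fR : forall r, R r -> eval_word f r = 1.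

Lemma pres_lift_class w : pres_lift f (pres_class w) = eval_word f w.
Proof. exact: (eval_word_pres_eq fR (pres_eq_repr w)). Qed.

Lemma pres_lift_gen x : pres_lift f (pres_gen x) = f x.
Proof. by rewrite pres_lift_class /eval_word big_seq1. Qed.

Lemma pres_liftM : {morph pres_lift f : g h / g * h}.
Proof.
move=> g h; rewrite -(pres_class_repr g) -(pres_class_repr h) -pres_classM.
by rewrite !pres_lift_class eval_word_cat.
Qed.

End Lift.

End PresentedGroup.

(* G has the presentation < X | R >, with x : X corresponding to f x in G. *)
Definition has_presentation (G : groupType) (X : choiceType)
    (R : word X -> Prop) (f : X -> G) : Prop :=
  exists phi : {multiplicative pres_group R -> G},
    bijective phi /\ forall x, phi (pres_gen R x) = f x.

Section Kernel.
Variables (G H : groupType) (f : {multiplicative G -> H}).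

Definition in_ker : pred G := fun g => f g == 1.

Lemma in_ker_mul_closed : mulg_closed in_ker.
Proof.
by move=> g h; rewrite !unfold_in /in_ker => /eqP fg /eqP fh;
  rewrite gmulfM fg fh mulg1.
Qed.

Lemma gmulf1_ker : f 1 = 1.
Proof. by apply: (mulgI (f 1)); rewrite -gmulfM !mulg1. Qed.

Lemma in_ker_1 : 1 \in in_ker.
Proof. by rewrite unfold_in /in_ker gmulf1_ker. Qed.

Lemma in_ker_inv_closed : invg_closed in_ker.
Proof.
move=> g; rewrite !unfold_in /in_ker => /eqP fg.
by rewrite -(mul1g (f _)) -{1}fg -gmulfM mulgV gmulf1_ker.
Qed.

Lemma in_ker_div g h : f g = f h -> in_ker (g * h^-1).
Proof. by move=> fgh; rewrite /in_ker gmulfM fgh -gmulfM mulgV gmulf1_ker. Qed.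

Record ker := Ker { ker_val : G; ker_valP : in_ker ker_val }.

HB.instance Definition _ := [isSub for ker_val].
HB.instance Definition _ := [Choice of ker by <:].

Lemma in_ker_group_closed : group_closed in_ker.
Proof.
by split=> [|g h kg kh]; [exact: in_ker_1|
  apply: in_ker_mul_closed => //; apply: in_ker_inv_closed].
Qed.

HB.instance Definition _ :=
  SubChoice_isSubGroup.Build G in_ker ker in_ker_group_closed.

End Kernel.

(* Finite simplicial complexes with vertex set V; simplices are non-empty. *)
Record complex (V : finType) := Complex {
  simplices : {set {set V}};
  set0_notin_simplices : set0 \notin simplices;
  set1_in_simplices : forall v, [set v] \in simplices;
  simplices_down : forall A B : {set V},
    A \in simplices -> B \subset A -> B != set0 -> B \in simplices
}.

Section Complex.
Variables (V : finType) (D : complex V).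

Definition adj : rel V := fun u v => (u != v) && ([set u; v] \in simplices D).

Definition is_flag : Prop :=
  forall A : {set V}, A != set0 ->
    {in A &, forall u v, u != v -> adj u v} -> A \in simplices D.

Definition is_nonempty : Prop := simplices D != set0.

Definition is_connected : Prop := forall u v : V, connect adj u v.

Definition raag_relator (r : word V) : Prop :=
  exists v w : V, adj v w /\ r = comm_word v w.

Definition raag : groupType := pres_group raag_relator.

Definition raag_gen (v : V) : raag := pres_gen raag_relator v.

(* Algebra.to_multiplicative int is Z written multiplicatively. *)
Definition height : raag -> Algebra.to_multiplicative int :=
  pres_lift (fun _ : V => (1%R : int) : Algebra.to_multiplicative int).

Lemma height_relator r : raag_relator r ->
  eval_word (fun _ : V => (1%R : int) : Algebra.to_multiplicative int) r = 1.
Proof. by case=> v [w [_ ->]]; rewrite /eval_word !big_cons big_nil. Qed.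

Lemma heightM : {morph height : g h / g * h}.
Proof. exact: (pres_liftM height_relator). Qed.

HB.instance Definition _ :=
  isMultiplicative.Build raag (Algebra.to_multiplicative int) height heightM.

Lemma height_gen v : height (raag_gen v) = (1%R : int).
Proof. exact: (pres_lift_gen height_relator). Qed.

Definition bestvina_brady : groupType := ker height.

(* The ordered pair (u, v) is the edge {u, v} directed from u to v. *)
Definition dedge : finType := {p : V * V | adj p.1 p.2}.

Definition iota_edge (e : dedge) : V := (val e).1.
Definition tau_edge (e : dedge) : V := (val e).2.

Definition directed_cycle (c : seq dedge) : bool :=
  cycle (fun e e' => tau_edge e == iota_edge e') c.

Definition cycle_relator (r : word dedge) : Prop :=
  exists (c : seq dedge) (n : int),
    [/\ (2 <= size c)%N, directed_cycle c, n != 0%R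
      & r = flatten [seq pow_word e n | e <- c]].

Lemma edge_elt_in_ker (e : dedge) :
  in_ker height (raag_gen (iota_edge e) * (raag_gen (tau_edge e))^-1).
Proof.
by apply: in_ker_div; apply: etrans (height_gen _) (esym (height_gen _)).
Qed.

Definition edge_elt (e : dedge) : bestvina_brady :=
  Ker (edge_elt_in_ker e).

End Complex.

(* Main.v *)
(** Fix a vertex [x0], and let [P] be the presented group. The cycle relators
make the product of the [e ^ n] along a walk from [x0] to [v] independent of the
walk; it plays the role of [x0 ^ n * v ^ (- n)] and is called [pot n v]. Since an
edge [e] starting at [v] commutes with [v] in the right-angled Artin group,
conjugation by [x0 ^ s] is seen in [P] as the endomorphism
[e |-> pot s v * e / pot s v]; these endomorphisms compose like the powers of
[x0]. They let the right-angled Artin group act on the set [P], as it acts on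
its cosets modulo [<x0>], in such a way that the image of [q : P] acts as left
multiplication by [q]. Hence [P] embeds in the Artin group. Conversely, every
[g] is the image of [g . 1 : P] times a power of [x0], and this power is
trivial when [g] has height 0. *)
Require Import Defs.
From HB Require Import structures.
From mathcomp Require Import all_boot all_algebra.

Set Implicit Arguments.
Unset Strict Implicit.
Unset Printing Implicit Defensive.

Import GRing.Theory.
Local Open Scope group_scope.

(** * Integer powers in a group *)

Section IntegerPowers.
Variable G : groupType.
Implicit Types (g h : G) (m n : int).

(** Split on the sign exactly as [pow_word] is, so that the two can be compared case by case. *)
Definition zpow g n : G :=
  match n with Posz k => g ^+ k | Negz k => g ^- k.+1 end.

Lemma zpow1 g : zpow g 1%R = g. Proof. by []. Qed.

Lemma zpowS g n : zpow g (n + 1)%R = zpow g n * g.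
Proof.
(* The exponent [-1] is apart: adding 1 leaves the [Negz] constructor. *)
case: n => [k|[|k]].
- by rewrite -PoszD addn1 /= expgSr.
- by rewrite /= mulVg.
- have -> : (Negz k.+1 + 1 = Negz k)%R.
    by rewrite !NegzE -(addn1 k.+1) PoszD opprD addrNK.
  by rewrite /= [g ^+ k.+2]expgS invgM mulgVK.
Qed.

Lemma zpowD g m n : zpow g (m + n)%R = zpow g m * zpow g n.
Proof.
elim: n => [|n IHn|n IHn]; first by rewrite addr0 mulg1.
- by rewrite -addn1 PoszD addrA !zpowS IHn mulgA.
- apply: (mulIg g); rewrite -mulgA -!zpowS -addrA.
  by rewrite -addn1 PoszD opprD addrNK.
Qed.

Lemma zpow_conjg a g n : zpow (a * g / a) n = a * zpow g n / a.
Proof.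
have conj_nat k : (a * g / a) ^+ k = a * g ^+ k / a.
  by have := conjXg g a^-1 k; rewrite !conjgE !invgK !mulgA => <-.
by case: n => k /=; rewrite conj_nat // !invgM invgK mulgA.
Qed.

Lemma zpow_divg g h n : commute g h -> zpow (g / h) n = zpow g n / zpow h n.
Proof.
move=> gh; case: n => k /=; rewrite expgnFl // invgF invgK.
exact/commuteV/commuteX2/commute_sym.
Qed.

End IntegerPowers.

Lemma gmulf_zpow (G H : groupType) (f : UMagmaMorphism.type G H) g n :
  f (zpow g n) = zpow (f g) n.
Proof. by case: n => k /=; rewrite ?gmulfV gmulfXn. Qed.

(** * Words and morphisms out of a presented group *)

Section Presentations.
Variables (X : choiceType) (R : word X -> Prop).

Lemma pres_genV x : pres_class R [:: (x, false)] = (pres_gen R x)^-1.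
Proof.
apply/esym/mulg1_eq; rewrite -pres_classM.
exact/pres_classP/(pres_cancel _ (x, true)).
Qed.

Lemma pres_class_prod w : pres_class R w = eval_word (pres_gen R) w.
Proof.
elim: w => [|[x b] w IHw]; first by rewrite /eval_word big_nil.
rewrite -cat1s pres_classM IHw /eval_word big_cat big_seq1 /=; congr (_ * _).
by case: b => //=; exact: pres_genV.
Qed.

Lemma eval_word_pow (G : groupType) (f : X -> G) x n :
  eval_word f (pow_word x n) = zpow (f x) n.
Proof.
have eval_nseq k b : eval_word f (nseq k (x, b)) = (if b then f x else (f x)^-1) ^+ k.
  by elim: k => [|k IHk]; rewrite /eval_word ?big_nil // big_cons expgS -IHk.
by case: n => k; rewrite eval_nseq //= expVgn.
Qed.

Lemma eval_word_flatten_pow (G : groupType) (f : X -> G) c n :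
  eval_word f (flatten [seq pow_word x n | x <- c]) = \prod_(x <- c) zpow (f x) n.
Proof.
elim: c => [|x c IHc]; first by rewrite /eval_word !big_nil.
by rewrite /= eval_word_cat IHc big_cons eval_word_pow.
Qed.

Lemma pres_lift_group_morphism (G : groupType) (f : X -> G) :
  (forall r, R r -> eval_word f r = 1) ->
  let phi := pres_lift f : pres_group R -> G in
  (phi 1 = 1) * {morph phi : g h / g * h}.
Proof.
move=> fR; split; last exact: pres_liftM.
by rewrite (pres_lift_class fR [::]) /eval_word big_nil.
Qed.

Definition pres_hom (G : groupType) (f : X -> G)
    (fR : forall r, R r -> eval_word f r = 1) :
    UMagmaMorphism.type (pres_group R) G :=
  HB.pack (pres_lift f : pres_group R -> G)
    (isUMagmaMorphism.Build _ _ _ (pres_lift_group_morphism fR)).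

Lemma pres_hom_gen (G : groupType) (f : X -> G) fR x :
  @pres_hom G f fR (pres_gen R x) = f x.
Proof. exact: pres_lift_gen. Qed.

Lemma pres_group_ind (K : pres_group R -> Prop) :
  K 1 -> (forall x, K (pres_gen R x)) -> (forall q, K q -> K q^-1) ->
  (forall q1 q2, K q1 -> K q2 -> K (q1 * q2)) -> forall q, K q.
Proof.
move=> K1 Kgen KV KM q; rewrite -(pres_class_repr q) pres_class_prod.
by apply: big_ind => // -[x []] _; [|apply: KV]; apply: Kgen.
Qed.

Lemma pres_hom_ext (G : groupType) (f1 f2 : UMagmaMorphism.type (pres_group R) G) :
  (forall x, f1 (pres_gen R x) = f2 (pres_gen R x)) -> f1 =1 f2.
Proof.
move=> f12; elim/pres_group_ind => [|//|q IHq|q1 q2 IH1 IH2].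
- by rewrite !gmulf1.
- by rewrite !gmulfV IHq.
- by rewrite !gmulfM IH1 IH2.
Qed.

End Presentations.

(** * Walks along directed edges *)

Section Walks.
Variables (V : finType) (D : complex V).
Local Notation dedge := (dedge D).
Implicit Types (u v w : V) (e : dedge) (p : seq dedge).

Lemma adj_sym : symmetric (adj D).
Proof. by move=> u v; rewrite /adj eq_sym setUC. Qed.

Lemma iota_neq_tau e : iota_edge e != tau_edge e.
Proof. by case/andP: (valP e). Qed.

Lemma rev_edge_subproof e : adj D (tau_edge e) (iota_edge e).
Proof. by rewrite adj_sym; exact: valP e. Qed.

Definition rev_edge e : dedge := exist _ (tau_edge e, iota_edge e) (rev_edge_subproof e).

Fixpoint is_walk u p w : bool :=
  if p is e :: p' then (iota_edge e == u) && is_walk (tau_edge e) p' w else u == w.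

Lemma is_walk_cat u p1 v p2 w :
  is_walk u p1 v -> is_walk v p2 w -> is_walk u (p1 ++ p2) w.
Proof.
elim: p1 u => [|e p1 IHp] u /=; first by move=> /eqP ->.
by move=> /andP[-> /IHp]; apply.
Qed.

Definition rev_walk p := rev (map rev_edge p).

Lemma is_walk_rev u p w : is_walk u p w -> is_walk w (rev_walk p) u.
Proof.
elim: p u => [|e p IHp] u /=; first by rewrite eq_sym.
move=> /andP[/eqP <- /IHp pw]; rewrite /rev_walk /= rev_cons -cats1.
by apply: is_walk_cat pw _; rewrite /= !eqxx.
Qed.

Lemma path_is_walk e p e' :
  path (fun e1 e2 => tau_edge e1 == iota_edge e2) e (rcons p e') =
  is_walk (tau_edge e) p (iota_edge e').
Proof.
by elim: p e => [|e1 p IHp] e /=; rewrite ?andbT // IHp eq_sym.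
Qed.

Lemma directed_cycle_is_walk e p :
  directed_cycle (e :: p) = is_walk (iota_edge e) (e :: p) (iota_edge e).
Proof. by rewrite /directed_cycle /= path_is_walk eqxx. Qed.

Lemma connect_is_walk u w : connect (adj D) u w -> exists p, is_walk u p w.
Proof.
move=> /connectP[s + ->] {w}; elim: s u => [|v s IHs] u /=.
  by exists [::] => /=.
move=> /andP[uv /IHs[p pw]].
by exists (exist _ (u, v) uv :: p); rewrite /= eqxx.
Qed.

(** Telescoping: consecutive edges share a vertex, so the inner values of [a] cancel. *)
Lemma prod_walk (G : groupType) (a : V -> G) (b : dedge -> G) u p w :
  is_walk u p w ->
  \prod_(e <- p) (a (iota_edge e) * b e / a (tau_edge e)) =
    a u * \prod_(e <- p) b e / a w.
Proof.
elim: p u => [|e p IHp] u /=; first by move=> /eqP ->; rewrite !big_nil mulg1 mulgV.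
by move=> /andP[/eqP <- /IHp pw]; rewrite !big_cons pw !mulgA mulgVK.
Qed.

End Walks.

(** * Potentials and shifts in the presented group *)

Section CycleGroup.
Variables (V : finType) (D : complex V).
Local Notation dedge := (dedge D).
Local Notation P := (pres_group (@cycle_relator V D)).
Local Notation gen := (pres_gen (@cycle_relator V D)).
Implicit Types (u v w : V) (e : dedge) (p : seq dedge) (s t n : int).

Definition walk_pow n p : P := \prod_(e <- p) zpow (gen e) n.

Lemma walk_pow_cat n p1 p2 : walk_pow n (p1 ++ p2) = walk_pow n p1 * walk_pow n p2.
Proof. exact: big_cat. Qed.

(** This is a relator except when [n] is zero or [p] has fewer than two edges. In the first case all
    factors are 1; in the second [p] is empty, as no edge is a loop. *)
Lemma walk_pow_closed n u p : is_walk u p u -> walk_pow n p = 1.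
Proof.
have [->|n0] := eqVneq n 0%R; first by move=> _; apply: big1.
case: p => [|e [|e' p]]; first by rewrite /walk_pow big_nil.
  by move=> /= /andP[/eqP <-]; rewrite eq_sym (negbTE (iota_neq_tau e)).
set c := [:: e, e' & p] => cu; rewrite /walk_pow -eval_word_flatten_pow -pres_class_prod.
apply/pres_classP/pres_relator; exists c, n; split=> //.
rewrite directed_cycle_is_walk -/c.
by have /andP[/eqP -> _] := cu.
Qed.

Lemma walk_pow_rev n p : walk_pow n (rev_walk p) = (walk_pow n p)^-1.
Proof.
elim: p => [|e p IHp]; first by rewrite /walk_pow big_nil invg1.
rewrite /rev_walk /= rev_cons -cats1 walk_pow_cat IHp -(cat1s e p) walk_pow_cat invgM.
(* An edge followed by its opposite is a directed cycle of length 2. *)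
congr (_ * _); apply/esym/mulg1_eq; rewrite -walk_pow_cat.
by apply: (@walk_pow_closed _ (iota_edge e)); rewrite /= !eqxx.
Qed.

Variables (x0 : V) (conn : is_connected D).

Definition walk_to v := xchoose (connect_is_walk (conn x0 v)).

Lemma walk_toP v : is_walk x0 (walk_to v) v.
Proof. exact: (xchooseP (connect_is_walk (conn x0 v))). Qed.

(* Stands for [x0 ^ n * v ^ (- n)]. *)
Definition pot n v : P := walk_pow n (walk_to v).

(** The chosen walk to [u], then [p], then the reverse of the chosen walk to [w] form a closed walk
    at [x0]. *)
Lemma pot_walk n u p w : is_walk u p w -> pot n w = pot n u * walk_pow n p.
Proof.
move=> pw; apply/esym/divg1_eq; rewrite -walk_pow_rev -!walk_pow_cat.
apply: (@walk_pow_closed _ x0); apply: is_walk_cat (is_walk_rev (walk_toP w)).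
exact: is_walk_cat (walk_toP u) pw.
Qed.

Lemma pot_tau n e : pot n (tau_edge e) = pot n (iota_edge e) * zpow (gen e) n.
Proof.
rewrite (@pot_walk n (iota_edge e) [:: e]) /= ?eqxx //.
by rewrite /walk_pow big_seq1.
Qed.

Lemma pot_root n : pot n x0 = 1.
Proof. exact: walk_pow_closed (walk_toP x0). Qed.

Lemma pot0 v : pot 0%R v = 1.
Proof. exact: big1. Qed.

(* Conjugation by [x0 ^ s] acts on the edge [e] as conjugation by
   [pot s (iota_edge e)] does, because [e] commutes with its initial vertex. *)
Definition shift_gen s e : P := pot s (iota_edge e) * gen e / pot s (iota_edge e).

(** Ending with [pot s (tau_edge e)] rather than with [pot s (iota_edge e)] raises the exponent by
    [s] and gives the form that telescopes along walks. *)
Lemma zpow_shift_gen s n e :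
  zpow (shift_gen s e) n =
    pot s (iota_edge e) * zpow (gen e) (n + s)%R / pot s (tau_edge e).
Proof.
by rewrite zpow_conjg pot_tau zpowD invgM !mulgA mulgK.
Qed.

Lemma prod_shift_gen s n u p w : is_walk u p w ->
  \prod_(e <- p) zpow (shift_gen s e) n = pot s u * walk_pow (n + s)%R p / pot s w.
Proof.
move=> pw; rewrite -(prod_walk (pot s) _ pw); apply: eq_bigr => e _.
exact: zpow_shift_gen.
Qed.

(** The relator of exponent [n] goes to a conjugate of the one of exponent [n + s] on the same
    cycle. That exponent may be 0, which [walk_pow_closed] allows. *)
Lemma shift_gen_relator s r : cycle_relator r -> eval_word (shift_gen s) r = 1.
Proof.
case=> -[|e p] [n [// _ + _ ->]]; rewrite directed_cycle_is_walk => cu.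
rewrite eval_word_flatten_pow (prod_shift_gen s n cu).
by rewrite (walk_pow_closed _ cu) mulg1 mulgV.
Qed.

Definition shift s : UMagmaMorphism.type P P := pres_hom (shift_gen_relator s).

Lemma shift_genE s e : shift s (gen e) = shift_gen s e.
Proof. exact: pres_hom_gen. Qed.

(** Under the reading of [pot], both sides are [x0 ^ (n + s) * v ^ (- n) * x0 ^ (- s)]. *)
Lemma shift_pot s n v : shift s (pot n v) = pot (n + s)%R v / pot s v.
Proof.
rewrite gmulf_prod.
under eq_bigr do rewrite gmulf_zpow shift_genE.
by rewrite (prod_shift_gen s n (walk_toP v)) pot_root mul1g.
Qed.

Lemma shift_shift s t q : shift s (shift t q) = shift (s + t)%R q.
Proof.
pose f := [the UMagmaMorphism.type P P of shift s \o shift t].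
apply: (@pres_hom_ext _ _ _ f) => e.
rewrite -[LHS]/(shift s (shift t (gen e))) !shift_genE /shift_gen.
rewrite gmulfF gmulfM shift_genE !shift_pot addrC /shift_gen.
by rewrite invgM invgK !mulgA !mulgVK.
Qed.

Lemma shift0 q : shift 0%R q = q.
Proof.
apply: (@pres_hom_ext _ _ _ _ [the UMagmaMorphism.type P P of idfun]) => e.
by rewrite shift_genE /shift_gen pot0 mul1g divg1.
Qed.

Lemma shiftK s t q : (s + t = 0)%R -> shift s (shift t q) = q.
Proof. by move=> st; rewrite shift_shift st shift0. Qed.

(* The action of the right-angled Artin group on its cosets modulo [<x0>]. *)
Definition act_letter (l : V * bool) (q : P) : P :=
  if l.2 then (pot 1%R l.1)^-1 * shift 1%R q else shift (-1)%R (pot 1%R l.1 * q).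

Definition act (w : word V) (q : P) : P := foldr act_letter q w.

Lemma act_pos v q : act_letter (v, true) q = (pot 1%R v)^-1 * shift 1%R q.
Proof. by []. Qed.

Lemma act_neg v q : act_letter (v, false) q = shift (-1)%R (pot 1%R v * q).
Proof. by []. Qed.

Lemma act_cat (w1 w2 : word V) q : act (w1 ++ w2) q = act w1 (act w2 q).
Proof. exact: foldr_cat. Qed.

Lemma act_letterK l q : act_letter l (act_letter (inv_letter l) q) = q.
Proof.
case: l => v []; rewrite /inv_letter [_ _.1 _]/= act_pos act_neg.
- by rewrite shiftK ?addrN // mulKg.
- by rewrite mulVKg shiftK ?addNr.
Qed.

(** By [pot_tau] with exponents 1 and 2, both sides are [(gen e)^-1 * (pot 2 (iota_edge e))^-1]
    times the double shift of [q]. *)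
Lemma act_letter_commute e q :
  act_letter (iota_edge e, true) (act_letter (tau_edge e, true) q) =
  act_letter (tau_edge e, true) (act_letter (iota_edge e, true) q).
Proof.
rewrite !act_pos !gmulfM !gmulfV !shift_pot !pot_tau (zpowD _ 1 1) zpow1.
by rewrite !invgM !invgK !mulgA !(mulgK, mulgVK) mulVg mul1g.
Qed.

Lemma act_pres_eq (w1 w2 : word V) : pres_eq (@raag_relator V D) w1 w2 -> act w1 =1 act w2.
Proof.
elim=> {w1 w2} //.
- by move=> u v _ IH q; rewrite IH.
- by move=> v u w _ IH1 _ IH2 q; rewrite IH1.
- by move=> u u' v v' _ IHu _ IHv q; rewrite !act_cat IHv IHu.
- by move=> l q; exact: act_letterK.
- move=> _ [v [w [vw ->]]] q; rewrite /act [foldr _ _ _]/=.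
  (* Once its last two letters are swapped, the commutator cancels from the inside out. *)
  rewrite (act_letter_commute (exist _ (v, w) vw)).
  by rewrite (act_letterK (w, false)) (act_letterK (v, false)).
Qed.

Definition edge_word e : word V := [:: (iota_edge e, true); (tau_edge e, false)].

Lemma act_edge_word e q : act (edge_word e) q = gen e * q.
Proof.
rewrite /edge_word /act [foldr _ _ _]/= act_pos act_neg.
by rewrite shiftK ?addrN // pot_tau zpow1 -mulgA mulKg.
Qed.

(** * Comparison with the right-angled Artin group and its kernel *)

Local Notation G := (raag D).
Local Notation g_ := (raag_gen D).

Lemma raag_gen_commute v w : adj D v w -> commute (g_ v) (g_ w).
Proof.
move=> vw; apply/commute_sym/commgP.
rewrite commgEl conjgE (_ : _ * _ = pres_class _ (comm_word w v)).
  by apply/eqP/pres_classP/pres_relator; exists w, v; rewrite adj_sym.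
by rewrite pres_class_prod /eval_word !big_cons big_nil /= mulg1.
Qed.

Definition edge_raag e : G := g_ (iota_edge e) / g_ (tau_edge e).

(** The factor 1 matches the shape required by [prod_walk]. *)
Lemma zpow_edge_raag n e :
  zpow (edge_raag e) n = zpow (g_ (iota_edge e)) n * 1 / zpow (g_ (tau_edge e)) n.
Proof. by rewrite mulg1; apply/zpow_divg/raag_gen_commute; exact: valP e. Qed.

Lemma edge_raag_walk n u p w : is_walk u p w ->
  \prod_(e <- p) zpow (edge_raag e) n = zpow (g_ u) n / zpow (g_ w) n.
Proof.
move=> pw; under eq_bigr do rewrite zpow_edge_raag.
by rewrite (prod_walk (fun v => zpow (g_ v) n) _ pw) big1 // mulg1.
Qed.

Lemma edge_raag_relator r : cycle_relator r -> eval_word edge_raag r = 1.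
Proof.
case=> -[|e p] [n [// _ + _ ->]]; rewrite directed_cycle_is_walk => cu.
by rewrite eval_word_flatten_pow (edge_raag_walk n cu) mulgV.
Qed.

Definition to_raag : UMagmaMorphism.type P G := pres_hom edge_raag_relator.

Lemma to_raag_gen e : to_raag (gen e) = edge_raag e.
Proof. exact: pres_hom_gen. Qed.

Lemma to_raag_pot n v : to_raag (pot n v) = zpow (g_ x0) n / zpow (g_ v) n.
Proof.
rewrite gmulf_prod -(edge_raag_walk n (walk_toP v)); apply: eq_bigr => e _.
by rewrite gmulf_zpow to_raag_gen.
Qed.

Lemma to_raag_shift s q :
  to_raag (shift s q) = zpow (g_ x0) s * to_raag q / zpow (g_ x0) s.
Proof.
elim/pres_group_ind: q => [|e|q IHq|q1 q2 IH1 IH2].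
- by rewrite !gmulf1 mulg1 mulgV.
- rewrite shift_genE gmulfF gmulfM !to_raag_gen !to_raag_pot.
  set v := iota_edge e; set x := zpow _ s; set y := zpow _ s.
  (* As [v] commutes with both ends of [e], the factor [y] of the image of [pot s v] drops out of
     the conjugation, leaving [x]. *)
  have ye : y^-1 * edge_raag e = edge_raag e * y^-1.
    apply/esym/commuteV; rewrite /commute.
    have vv : commute (g_ v) (edge_raag e).
      apply: commuteM => //; apply/commuteV/raag_gen_commute/(valP e).
    rewrite /y; case: (s) => k /=; [|apply: commuteV]; apply: commuteX;
    exact: commute_sym.
  by rewrite invgF -[x / y * _]mulgA ye !mulgA mulgVK.
- by rewrite !gmulfV IHq invgF invgM mulgA.
- by rewrite !gmulfM IH1 IH2 !mulgA mulgVK.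
Qed.

Lemma act_repr (w : word V) : act (repr (pres_class (@raag_relator V D) w)) =1 act w.
Proof. exact/act_pres_eq/pres_eq_repr. Qed.

Lemma act_reprM (g h : G) q : act (repr (g * h)) q = act (repr g) (act (repr h) q).
Proof.
by rewrite -act_cat -[RHS]act_repr pres_classM !pres_class_repr.
Qed.

(** Applied to [q' = 1], this recovers [q] from its image, so [to_raag] is injective. *)
Lemma act_to_raag q q' : act (repr (to_raag q)) q' = q * q'.
Proof.
elim/pres_group_ind: q q' => [|e|q IHq|q1 q2 IH1 IH2] q'.
- by rewrite gmulf1 act_repr mul1g.
- rewrite to_raag_gen -act_edge_word -[RHS]act_repr pres_class_prod.
  by rewrite /eval_word !big_cons big_nil /= mulg1.
(* Write [q'] as [q * (q^-1 * q')], so that the action of the image of [q] is undone. *)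
- rewrite -{1}(mulVKg q q') -IHq -act_reprM gmulfV mulVg.
  by rewrite act_repr.
- by rewrite gmulfM act_reprM IH1 IH2 mulgA.
Qed.

(** The letter [v] equals [to_raag (pot 1 v)^-1 * x0]; moving [x0] to the right past the image of
    [P] applies [shift 1] and adds 1 to the exponent. *)
Lemma to_raag_act (w : word V) :
  exists n, pres_class _ w = to_raag (act w 1) * zpow (g_ x0) n.
Proof.
elim: w => [|[v b] w [n IHw]].
  by exists 0%R; rewrite gmulf1 mulg1.
rewrite -cat1s pres_classM IHw act_cat; case: b.
- exists (1 + n)%R; rewrite -[act [:: _] _]/(act_letter (v, true) (act w 1)) act_pos.
  rewrite gmulfM gmulfV to_raag_pot to_raag_shift zpowD !zpow1.
  by rewrite invgF !mulgA !mulgVK.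
- exists (-1 + n)%R; rewrite -[act [:: _] _]/(act_letter (v, false) (act w 1)) act_neg.
  rewrite to_raag_shift gmulfM to_raag_pot zpowD !zpow1 pres_genV.
  by rewrite !mulgA !mulgVK mulVg mul1g.
Qed.

Lemma height_zpow v n : height (zpow (g_ v) n) = n.
Proof.
rewrite -eval_word_pow -pres_class_prod /height (pres_lift_class (@height_relator V D)).
rewrite eval_word_pow.
have expg_nat k : (1%R : Algebra.to_multiplicative int) ^+ k = Posz k.
  by elim: k => // k IHk; rewrite expgS IHk -addn1 addnC PoszD.
by case: n => k; rewrite /= expg_nat ?NegzE.
Qed.

Lemma edge_elt_relator r : cycle_relator r -> eval_word (@edge_elt V D) r = 1.
Proof.
(* The inclusion of the kernel is injective, so the relation is checked in [G]. *)
move=> rR; apply: val_inj; rewrite -[RHS](edge_raag_relator rR).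
by rewrite /eval_word; elim/big_ind2: _ => //= [? ? ? ? <- <-|[e []]].
Qed.

Definition to_ker : UMagmaMorphism.type P (bestvina_brady D) := pres_hom edge_elt_relator.

Lemma val_to_ker q : ker_val (to_ker q) = to_raag q.
Proof.
elim/pres_group_ind: q => [|e|q IHq|q1 q2 IH1 IH2].
- by rewrite !gmulf1.
- by rewrite to_raag_gen pres_hom_gen.
- by rewrite !gmulfV -IHq.
- by rewrite !gmulfM -IH1 -IH2.
Qed.

Lemma height_ker_val (k : bestvina_brady D) : height (ker_val k) = 0%R.
Proof. exact/eqP/(ker_valP k). Qed.

Lemma ker_val_act (k : bestvina_brady D) : to_raag (act (repr (ker_val k)) 1) = ker_val k.
Proof.
have [n] := to_raag_act (repr (ker_val k)); rewrite pres_class_repr.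
set q := act _ _ => kE; suff n0 : n = 0%R by rewrite kE n0 mulg1.
(* Images of [P] have height 0, so comparing heights leaves only [n]. *)
have := height_ker_val k; rewrite kE heightM height_zpow -val_to_ker height_ker_val.
by rewrite [_ * _]add0r.
Qed.

Lemma to_ker_bij : bijective to_ker.
Proof.
exists (fun k : bestvina_brady D => act (repr (ker_val k)) 1) => [q|k].
- by rewrite val_to_ker act_to_raag mulg1.
- by apply: val_inj; exact: etrans (val_to_ker _) (ker_val_act k).
Qed.

End CycleGroup.

Theorem theorem1 (V : finType) (D : complex V)
    (hne : is_nonempty D) (hconn : is_connected D) (hflag : is_flag D) :
  has_presentation (@cycle_relator V D) (@edge_elt V D).
Proof.
(* Any vertex of any simplex can serve as the base point [x0]. *)
have [A AD] := set0Pn _ hne.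
have /set0Pn[x0 _] : A != set0.
  by apply: contraTneq AD => ->; exact: set0_notin_simplices.
exists (to_ker D); split=> [|e]; last exact: (pres_lift_gen (@edge_elt_relator V D)).
exact: (to_ker_bij x0 hconn).
Qed.
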